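(* Let $f(\cdot;\Theta):\mathbb{R}^d\to\mathbb{R}$ be a family of prediction functions with parameter $\Theta$ in a finite-dimensional real vector space, such that for some $a>0$, $f(x;c\Theta)=c^af(x;\Theta)$ for all $c>0$ and all $x,\Theta$, and such that $f(x;\Theta)$ is continuous in $\Theta$. Let $(x_i,y_i)_{i=1}^n$, $x_i\in\mathbb{R}^d$, $y_i\in\{-1,+1\}$, be training data, let $\|\cdot\|$ be any norm on the parameter space, and fix $r>0$. For $\lambda>0$ let $$L_\lambda(\Theta)=\frac1n\sum_{i=1}^n\log\big(1+\exp(-y_if(x_i;\Theta))\big)+\lambda\|\Theta\|^r,\qquad \Theta_\lambda\in\arg\min_\Theta L_\lambda(\Theta),$$ let $\gamma_\lambda=\min_iy_if\big(x_i;\Theta_\lambda/\|\Theta_\lambda\|\big)$ be the normalized margin of $\Theta_\lambda$, and let $\gamma^\star=\max_{\|\Theta\|\le1}\min_iy_if(x_i;\Theta)$. Assume $\gamma^\star>0$ (the training data is separable by a member of the family). Then $$\gamma_\lambda\to\gamma^\star\quad\text{as }\lambda\to0 .$$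
   Context: The limit is as $\lambda\to0^+$, for any choice of global minimizers $\Theta_\lambda$ (which exist for every $\lambda>0$). *)

(* Defs.v *)
From HB Require Import structures.
From mathcomp Require Import all_boot all_order all_algebra.
From mathcomp Require Import all_classical all_reals all_analysis.

Set Implicit Arguments.
Unset Strict Implicit.
Unset Printing Implicit Defensive.

Import Order.TTheory GRing.Theory Num.Theory.
Import numFieldNormedType.Exports.

Local Open Scope classical_set_scope.
Local Open Scope ring_scope.

Definition finite_dimensional (R : realType) (V : normedModType R) : Prop :=
  exists (p : nat) (b : 'I_p -> V),
    forall v : V, exists c : 'I_p -> R, v = \sum_(i < p) c i *: b i.

(* Degree-[a] positive homogeneity in the parameter; [c `^ a] is the real power. *)
Definition pos_homogeneous (R : realType) (X : Type) (V : normedModType R)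
    (f : X -> V -> R) (a : R) : Prop :=
  forall (c : R) (x : X) (theta : V), 0 < c -> f x (c *: theta) = c `^ a * f x theta.

(* The sample is indexed by ['I_n.+1]: it has [n.+1] points, so that it is
   nonempty and the mean and the minimum over the sample make sense. *)

Definition reg_loss (R : realType) (X : Type) (V : normedModType R)
    (f : X -> V -> R) (n : nat) (x : 'I_n.+1 -> X) (y : 'I_n.+1 -> R)
    (r lambda : R) (theta : V) : R :=
  (n.+1%:R)^-1 * (\sum_(i < n.+1) ln (1 + expR (- (y i * f (x i) theta))))
  + lambda * `|theta| `^ r.

Definition is_argmin (R : realType) (T : Type) (F : T -> R) (t : T) : Prop :=
  forall s : T, F t <= F s.

(* The value at [ord0] only serves as the neutral start of the iterated
   minimum; it is one of the values the minimum ranges over. *)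
Definition margin (R : realType) (X : Type) (V : normedModType R)
    (f : X -> V -> R) (n : nat) (x : 'I_n.+1 -> X) (y : 'I_n.+1 -> R)
    (theta : V) : R :=
  \big[Num.min/ y ord0 * f (x ord0) theta]_(i < n.+1) (y i * f (x i) theta).

(* At [theta = 0] this is [margin f x y 0], since [0^-1 = 0]. *)
Definition normalized_margin (R : realType) (X : Type) (V : normedModType R)
    (f : X -> V -> R) (n : nat) (x : 'I_n.+1 -> X) (y : 'I_n.+1 -> R)
    (theta : V) : R :=
  margin f x y (`|theta|^-1 *: theta).

(* [sup] is total (0 on sets without a supremum); that this one is a maximum
   has to be established separately. *)
Definition max_margin (R : realType) (X : Type) (V : normedModType R)
    (f : X -> V -> R) (n : nat) (x : 'I_n.+1 -> X) (y : 'I_n.+1 -> R) : R :=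
  sup [set margin f x y theta | theta in [set theta : V | `|theta| <= 1]].

Definition is_max (R : realType) (A : set R) (m : R) : Prop :=
  A m /\ ubound A m.

(* Main.v *)
Require Import Defs.
From HB Require Import structures.
From mathcomp Require Import all_boot all_order all_algebra.
From mathcomp Require Import all_classical all_reals all_analysis.
From mathcomp Require Import ring.
Import Order.TTheory GRing.Theory Num.Theory.
Import numFieldNormedType.Exports.
Local Open Scope classical_set_scope.
Local Open Scope ring_scope.

(* In finite dimension the closed balls of V are compact, so the maximal margin
   and the minimizers of the regularized loss exist.  Write g for the maximal
   margin, attained at v in the unit ball, N for the sample size, and
   l(u) = log(1 + exp(-u)).  On the ball of radius K the mean loss is at least
   l(K^a g) / N > 0, whereas min L_lambda -> 0 along the ray of v; hence
   |Theta_lambda| -> infinity.  Comparing Theta_lambda with |Theta_lambda| v,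
   which has no larger norm, the regularizers drop out: with
   s = |Theta_lambda|^a, the normalized margin m satisfies
   l(s m) <= N l(s g).  As exp(-u) / 2 <= l(u) <= exp(-u) for u >= 0, m <= g - e
   would force exp(s e) <= 2 N, which fails for large s. *)

(** * Compactness of closed balls in finite dimension *)

Definition lincomb {R : realType} {V : normedModType R} {p : nat}
    (b : 'I_p -> V) (c : 'rV[R]_p) : V := \sum_(i < p) c ord0 i *: b i.

(* A nontrivial relation expresses one vector through the others, which can
   then be removed. *)
Lemma spanning_free_family {R : realType} {V : normedModType R} {p : nat}
    (b : 'I_p -> V) :
  (forall v, exists c, v = lincomb b c) ->
  exists (q : nat) (e : 'I_q -> V),
    (forall v, exists c, v = lincomb e c) /\
    (forall c, lincomb e c = 0 -> c = 0).
Proof.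
elim: p b => [|p IH] b span_b.
  by exists 0%N, b; split=> // c _; apply/rowP => -[].
have [free_b|] := pselect (forall c, lincomb b c = 0 -> c = 0).
  by exists p.+1, b.
move=> /existsNP[c /not_implyP[c_rel /eqP/rV0Pn[i0 ci0]]].
apply: (IH (b \o lift i0)) => v.
have [d ->] := span_b v.
(* Subtracting [k] times the relation [c] cancels the coefficient of [b i0]. *)
pose k := d ord0 i0 / c ord0 i0.
exists (\row_j (d ord0 (lift i0 j) - k * c ord0 (lift i0 j))).
rewrite -[LHS]subr0 -(scaler0 _ k) -c_rel /lincomb scaler_sumr -sumrB.
rewrite (bigD1_ord i0) //= scalerA -scalerBl /k divfK // subrr scale0r add0r.
by apply: eq_bigr => j _; rewrite mxE scalerA -scalerBl.
Qed.

Lemma lincombZ {R : realType} {V : normedModType R} {p : nat} (b : 'I_p -> V)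
    (k : R) (c : 'rV[R]_p) :
  lincomb b (k *: c) = k *: lincomb b c.
Proof.
by rewrite /lincomb scaler_sumr; apply: eq_bigr => i _; rewrite mxE scalerA.
Qed.

Lemma lincomb_continuous {R : realType} {V : normedModType R} {p : nat}
    (b : 'I_p -> V) :
  continuous (lincomb b).
Proof.
apply: continuous_big => [|i _ c]; first exact: add_continuous.
by apply: (@cvgZr_tmp _ _ _ _ (nbhs_filter c)); exact: coord_continuous.
Qed.

(** By freeness the norm of [lincomb b] has a positive minimum on the compact unit sphere of
    coordinates; [M] is its inverse, and homogeneity covers the other [c]. *)
Lemma lincomb_coercive {R : realType} {V : normedModType R} {p : nat}
    (b : 'I_p -> V) :
  (forall c, lincomb b c = 0 -> c = 0) ->
  exists M : R, 0 < M /\ forall c, `|c| <= M * `|lincomb b c|.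
Proof.
move=> free_b.
have unit_norm (c : 'rV[R]_p) : c != 0 -> `| `|c|^-1 *: c| = 1.
  by move=> c0; rewrite normrZ ger0_norm ?invr_ge0// mulVf// normr_eq0.
pose S := [set c : 'rV[R]_p | `|c| = 1].
(* The sphere is empty when [p = 0]; then every [c] is zero and any [M] works. *)
have [S0|/set0P/negP/negPn/eqP S0] := pselect (S !=set0); last first.
  exists 1; split=> // c; have [->|c0] := eqVneq c 0.
    by rewrite normr0 mulr_ge0.
  have : S (`|c|^-1 *: c) by exact: unit_norm.
  by rewrite S0.
have cnorm : continuous (fun c => `|lincomb b c|).
  move=> c; apply: continuous_comp; [exact: lincomb_continuous|].
  exact: norm_continuous.
have cS : compact S.
  apply: bounded_closed_compact.
    by exists 1; split=> // M M1 c /= ->; exact: ltW.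
  apply: (@preimage_closed _ _ (fun c : 'rV[R]_p => `|c|) [set 1]) => //.
  by move=> ? _; exact: norm_continuous.
have [c0 /set_mem /= c01 c0min] := EVT_min_rV S0 cS (continuous_subspaceT cnorm).
have m0 : 0 < `|lincomb b c0|.
  rewrite normr_gt0; apply/eqP => /free_b c00.
  by move: c01; rewrite /S /= c00 normr0 => /esym/eqP; rewrite oner_eq0.
exists `|lincomb b c0|^-1; split=> [|c]; first by rewrite invr_gt0.
have [->|cn0] := eqVneq c 0.
  by rewrite normr0 mulr_ge0 // invr_ge0 ltW.
rewrite mulrC ler_pdivlMr // mulrC -ler_pdivlMr ?normr_gt0 //.
have := c0min (`|c|^-1 *: c).
rewrite inE => /(_ (unit_norm _ cn0)).
by rewrite lincombZ normrZ ger0_norm ?invr_ge0 // mulrC.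
Qed.

(** The ball is the image under [lincomb e] of a coordinate set that is closed by continuity and
    bounded by coercivity. *)
Lemma closed_ball_compact {R : realType} {V : normedModType R} :
  finite_dimensional V ->
  forall rho : R, compact [set v : V | `|v| <= rho].
Proof.
move=> [p [b span_b]] rho.
have [|q [e [span_e free_e]]] := spanning_free_family b.
  move=> v; have [c ->] := span_b v; exists (\row_i c i).
  by apply: eq_bigr => i _; rewrite mxE.
have [M [M0 coercive]] := lincomb_coercive e free_e.
have ce : continuous (lincomb e) := lincomb_continuous e.
have -> : [set v : V | `|v| <= rho] =
    lincomb e @` [set c | `|lincomb e c| <= rho].
  apply/seteqP; split=> [v vr|_ [c cr <-]//].
  by have [c vE] := span_e v; exists c => //=; rewrite -vE.
apply: continuous_compact; first exact: continuous_subspaceT.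
apply: bounded_closed_compact.
  exists (M * rho); split; first exact: num_real.
  move=> K MK c /= cr; rewrite (le_trans (coercive c))//.
  by rewrite (le_trans _ (ltW MK))// ler_pM2l.
apply: (@preimage_closed _ _ (fun c => `|lincomb e c|) [set t | t <= rho]) => //.
move=> c _; apply: continuous_comp; [exact: ce|exact: norm_continuous].
Qed.

(** * Continuity and scaling of the margin *)

Lemma continuous_bigmin {R : realType} {T : topologicalType} {I : Type}
    (s : seq I) (g : T -> R) (F : I -> T -> R) :
  continuous g -> (forall i, continuous (F i)) ->
  continuous (fun t => \big[Num.min/g t]_(i <- s) F i t).
Proof.
move=> cg cF; elim: s => [|i s IH].
  by under [X in continuous X]funext do rewrite big_nil.
under [X in continuous X]funext do rewrite big_cons.
by move=> t; apply: (@continuous_min R T (F i)); [exact: cF|exact: IH].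
Qed.

(** Away from 0 the power is derivable; at 0, where it need not be, the radius e^(1/r) works
    directly. *)
Lemma powR_norm_continuous {R : realType} (r : R) :
  0 < r -> continuous (fun t : R => `|t| `^ r).
Proof.
move=> r0 t; have [->|t0] := eqVneq t 0.
  rewrite /continuous_at normr0 powR0 ?gt_eqF//.
  apply/cvgrPdist_lt => e e0; rewrite near_simpl /=.
  apply/nbhs_ballP; exists (e `^ r^-1) => /=; first exact: powR_gt0.
  move=> s; rewrite /ball /= !sub0r !normrN => se.
  rewrite ger0_norm ?powR_ge0//.
  have -> : e = (e `^ r^-1) `^ r.
    by rewrite -powRrM mulVf ?gt_eqF// powRr1// ltW.
  by rewrite gt0_ltr_powR// nnegrE ?powR_ge0.
have nt0 : 0 < `|t| by rewrite normr_gt0.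
apply: (@continuous_comp _ _ _ (fun t : R => `|t|) (fun u => u `^ r)).
  exact: norm_continuous.
apply: differentiable_continuous; apply/derivable1_diffP.
have /(@derivable_powR R 1 r) : `|t| \in `]0, +oo[ by rewrite in_itv /= nt0.
exact.
Qed.

Lemma margin_continuous {R : realType} {X : Type} {V : normedModType R}
    {f : X -> V -> R} {n : nat} (x : 'I_n.+1 -> X) (y : 'I_n.+1 -> R) :
  (forall x, continuous (f x)) -> continuous (margin f x y).
Proof.
move=> cf; have cyf i : continuous (fun theta => y i * f (x i) theta).
  by move=> theta; apply: cvgM; [exact: cvg_cst|exact: cf].
exact: continuous_bigmin.
Qed.

Lemma margin_le {R : realType} {X : Type} {V : normedModType R}
    (f : X -> V -> R) {n : nat} (x : 'I_n.+1 -> X) (y : 'I_n.+1 -> R)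
    (theta : V) (i : 'I_n.+1) :
  margin f x y theta <= y i * f (x i) theta.
Proof. exact: bigmin_le. Qed.

Lemma margin_attained {R : realType} {X : Type} {V : normedModType R}
    (f : X -> V -> R) {n : nat} (x : 'I_n.+1 -> X) (y : 'I_n.+1 -> R)
    (theta : V) :
  exists i, margin f x y theta = y i * f (x i) theta.
Proof.
rewrite /margin; elim/big_ind: _ => [|u v [i ->] [j ->]|i _].
- by exists ord0.
- by rewrite /Num.min; case: ifP => _; [exists i | exists j].
- by exists i.
Qed.

Lemma marginZ {R : realType} {X : Type} {V : normedModType R}
    {f : X -> V -> R} {a : R} {n : nat} (x : 'I_n.+1 -> X) (y : 'I_n.+1 -> R)
    (c : R) (theta : V) :
  pos_homogeneous f a -> 0 < c ->
  margin f x y (c *: theta) = c `^ a * margin f x y theta.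
Proof.
move=> homf c0; rewrite /margin.
(* A nonnegative factor commutes with the minimum; the starting value is scaled too. *)
rewrite (@big_morph _ _ ( *%R (c `^ a)) (c `^ a * (y ord0 * f (x ord0) theta))
  Num.min) //; last first.
  by move=> u v; rewrite minr_pMr ?powR_ge0.
rewrite homf// mulrCA; apply: eq_bigr => i _.
by rewrite homf// mulrCA.
Qed.

(** * Bounds on the logistic loss and on the regularized loss *)

Definition logistic {R : realType} (u : R) : R := ln (1 + expR (- u)).

Lemma logistic_decreasing {R : realType} :
  {homo @logistic R : u v / v <= u >-> u <= v}.
Proof.
move=> u v vu; rewrite ler_ln ?posrE ?addr_gt0 ?expR_gt0//.
by rewrite lerD2l ler_expR lerN2.
Qed.

Lemma logistic_gt0 {R : realType} (u : R) : 0 < logistic u.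
Proof. by rewrite ln_gt0// ltrDl expR_gt0. Qed.

Lemma logistic_le {R : realType} (u : R) : logistic u <= expR (- u).
Proof. by apply: le_ln1Dx; rewrite (lt_trans _ (expR_gt0 _))// ltrN10. Qed.

(** With w = exp(-u) <= 1, ln(1 + w) = -ln(1 - w/(1 + w)) >= w/(1 + w) >= w/2. *)
Lemma logistic_ge {R : realType} (u : R) :
  0 <= u -> expR (- u) / 2 <= logistic u.
Proof.
move=> u0; rewrite /logistic.
have := expR_gt0 (- u); have : expR (- u) <= 1 by rewrite expR_le1 oppr_le0.
move: (expR _) => w w1 w0.
have w1_gt0 : 0 < 1 + w by rewrite addr_gt0.
have : ln (1 - w / (1 + w)) <= - (w / (1 + w)).
  by apply: le_ln1Dx; rewrite ltrN2 ltr_pdivrMr// mul1r ltrDr.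
have -> : 1 - w / (1 + w) = (1 + w)^-1 by field; rewrite gt_eqF.
rewrite lnV ?posrE// lerN2; apply: le_trans.
by rewrite ler_pM2l// lef_pV2 ?posrE// lerD2l.
Qed.

Lemma logistic_continuous {R : realType} : continuous (@logistic R).
Proof.
move=> u.
apply: (@continuous_comp _ _ _ (fun u : R => 1 + expR (- u)) (@ln R)).
  apply: cvgD; first exact: cvg_cst.
  apply: (@continuous_comp _ _ _ (fun u : R => - u) expR).
    exact: opp_continuous.
  exact: continuous_expR.
by apply: continuous_ln; rewrite addr_gt0 ?expR_gt0.
Qed.

Lemma reg_loss_continuous {R : realType} {X : Type} {V : normedModType R}
    {f : X -> V -> R} {n : nat} (x : 'I_n.+1 -> X) (y : 'I_n.+1 -> R)
    (r lambda : R) :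
  (forall x, continuous (f x)) -> 0 < r ->
  continuous (reg_loss f x y r lambda).
Proof.
move=> cf r0.
have normr_cont : continuous (fun v : V => `|v| `^ r).
  have -> : (fun v : V => `|v| `^ r) = (fun t : R => `|t| `^ r) \o Num.norm.
    by apply/funext => v /=; rewrite normr_id.
  move=> v; apply: continuous_comp; first exact: norm_continuous.
  exact: powR_norm_continuous.
move=> theta; apply: cvgD; last first.
  by apply: cvgM; [exact: cvg_cst|exact: normr_cont].
apply: cvgM; first exact: cvg_cst.
move: theta; apply: continuous_big => [|i _ theta].
  exact: add_continuous.
apply: (@continuous_comp _ _ _ (fun v => y i * f (x i) v) logistic).
  by apply: cvgM; [exact: cvg_cst|exact: cf].
exact: logistic_continuous.
Qed.

Lemma reg_loss_le {R : realType} {X : Type} {V : normedModType R}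
    (f : X -> V -> R) {n : nat} (x : 'I_n.+1 -> X) (y : 'I_n.+1 -> R)
    (r lambda : R) (theta : V) :
  reg_loss f x y r lambda theta
    <= logistic (margin f x y theta) + lambda * `|theta| `^ r.
Proof.
rewrite lerD2r ler_pdivrMl ?ltr0n//.
rewrite mulrC mulr_natr -[X in _ *+ X]card_ord -sumr_const.
by apply: ler_sum => i _; apply: logistic_decreasing; exact: margin_le.
Qed.

(** Only the term of a sample point attaining the margin is kept; the others are positive. *)
Lemma reg_loss_ge {R : realType} {X : Type} {V : normedModType R}
    (f : X -> V -> R) {n : nat} (x : 'I_n.+1 -> X) (y : 'I_n.+1 -> R)
    (r lambda : R) (theta : V) :
  n.+1%:R^-1 * logistic (margin f x y theta) + lambda * `|theta| `^ r
    <= reg_loss f x y r lambda theta.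
Proof.
rewrite lerD2r ler_pM2l ?invr_gt0 ?ltr0n//.
have [i ->] := margin_attained f x y theta.
rewrite (bigD1 i) //= lerDl.
by apply: sumr_ge0 => j _; exact: ltW (logistic_gt0 _).
Qed.

(** * Existence of the maximal margin and of minimizers *)

Lemma margin_maximum {R : realType} {X : Type} {V : normedModType R}
    {f : X -> V -> R} {n : nat} (x : 'I_n.+1 -> X) (y : 'I_n.+1 -> R) :
  finite_dimensional V -> (forall x, continuous (f x)) ->
  is_max [set margin f x y theta | theta in [set theta : V | `|theta| <= 1]]
         (max_margin f x y).
Proof.
move=> fdV cf; set A := [set _ | _ in _].
have B0 : [set v : V | `|v| <= 1] !=set0 by exists 0; rewrite /= normr0.
have [v /set_mem /= v1 vmax] := compact_EVT_max B0 (closed_ball_compact fdV 1)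
  (continuous_subspaceT (margin_continuous x y cf)).
have ubv : ubound A (margin f x y v).
  by move=> _ [w w1 <-]; apply: vmax; rewrite inE.
have Av : A (margin f x y v) by exists v.
(* An attained upper bound is the supremum, so [sup] does not take its default value. *)
suff -> : max_margin f x y = margin f x y v by [].
apply/eqP; rewrite eq_le; apply/andP; split.
  by apply: ge_sup => //; exists (margin f x y v).
by apply: ub_le_sup => //; exists (margin f x y v).
Qed.

(** The radius [rho] solves lambda rho^r = L(0). Outside this ball the regularizer alone is at least
    L(0), so a minimizer over the compact ball is global. *)
Lemma reg_loss_argmin {R : realType} {X : Type} {V : normedModType R}
    {f : X -> V -> R} {n : nat} (x : 'I_n.+1 -> X) (y : 'I_n.+1 -> R)
    (r lambda : R) :
  finite_dimensional V -> (forall x, continuous (f x)) ->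
  0 < r -> 0 < lambda ->
  exists theta, is_argmin (reg_loss f x y r lambda) theta.
Proof.
move=> fdV cf r0 l0; set L := reg_loss f x y r lambda.
have L0 : 0 <= L 0.
  apply: le_trans (reg_loss_ge f x y r lambda 0).
  by rewrite addr_ge0// mulr_ge0 ?powR_ge0 ?(ltW l0) ?invr_ge0// ltW ?logistic_gt0.
pose rho := (L 0 / lambda) `^ r^-1.
have rhor : rho `^ r = L 0 / lambda.
  rewrite /rho -powRrM mulVf ?gt_eqF// powRr1// divr_ge0//; exact: ltW.
have B0 : [set v : V | `|v| <= rho] !=set0.
  by exists 0; rewrite /= normr0 powR_ge0.
have [v _ vmin] := compact_EVT_min B0 (closed_ball_compact fdV rho)
  (continuous_subspaceT (reg_loss_continuous x y r lambda cf r0)).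
exists v => w; have [wrho|rhow] := leP `|w| rho; first by apply: vmin; rewrite inE.
have L0v : L v <= L 0 by apply: vmin; rewrite inE /= normr0 powR_ge0.
apply: (le_trans L0v); apply: le_trans (reg_loss_ge f x y r lambda w).
have : L 0 <= lambda * `|w| `^ r.
  rewrite -ler_pdivrMl// mulrC -rhor ge0_ler_powR ?nnegrE ?powR_ge0//; exact: ltW.
move=> /le_trans; apply; rewrite lerDr mulr_ge0 ?invr_ge0//.
exact: ltW (logistic_gt0 _).
Qed.

(** * Divergence of the norms of the minimizers *)

Lemma margin_le_powR {R : realType} {X : Type} {V : normedModType R}
    {f : X -> V -> R} {a : R} {n : nat} (x : 'I_n.+1 -> X) (y : 'I_n.+1 -> R)
    (g K : R) (theta : V) :
  pos_homogeneous f a ->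
  ubound [set margin f x y theta | theta in [set theta : V | `|theta| <= 1]] g ->
  0 < K -> `|theta| <= K -> margin f x y theta <= K `^ a * g.
Proof.
move=> homf ubg K0 thetaK.
have -> : theta = K *: (K^-1 *: theta) by rewrite scalerA divff ?gt_eqF// scale1r.
rewrite (marginZ _ _ _ _ homf K0) ler_pM2l ?powR_gt0//; apply: ubg.
exists (K^-1 *: theta) => //=; rewrite normrZ gtr0_norm ?invr_gt0//.
by rewrite ler_pdivrMl// mulr1.
Qed.

(** The witness solves rho^a g = 1/e, and exp(1/e) >= 1 + 1/e > 1/e. *)
Lemma exists_large_radius {R : realType} (a g e : R) :
  0 < a -> 0 < g -> 0 < e ->
  exists rho : R, 0 < rho /\ expR (- (rho `^ a * g)) < e.
Proof.
move=> a0 g0 e0; exists ((e * g)^-1 `^ a^-1).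
have eg0 : 0 < (e * g)^-1 by rewrite invr_gt0 mulr_gt0.
split; first exact: powR_gt0.
rewrite -powRrM mulVf ?gt_eqF// powRr1 ?ltW// invfM -mulrA mulVf ?gt_eqF// mulr1.
rewrite expRN invf_plt ?posrE ?expR_gt0//.
by apply: lt_le_trans (expR_ge1Dx _); rewrite ltrDr.
Qed.

Lemma argmin_norm_large {R : realType} {X : Type} {V : normedModType R}
    {f : X -> V -> R} {a : R} {n : nat} (x : 'I_n.+1 -> X) (y : 'I_n.+1 -> R)
    (r g : R) (Theta : R -> V) :
  pos_homogeneous f a -> 0 < a -> 0 < r -> 0 < g ->
  is_max [set margin f x y theta | theta in [set theta : V | `|theta| <= 1]] g ->
  (forall lambda, 0 < lambda ->
     is_argmin (reg_loss f x y r lambda) (Theta lambda)) ->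
  forall K : R, 0 < K -> \forall lambda \near 0^'+, K < `|Theta lambda|.
Proof.
move=> homf a0 r0 g0 [[v /= v1 vg] ubg] argTheta K K0.
(* [delta] bounds the loss from below on the ball of radius [K]. The competitor [rho *: v] beats it:
   [rho] brings the data term below [delta / 2], then a small [lambda] does the same for the
   regularizer. *)
pose delta := n.+1%:R^-1 * logistic (K `^ a * g).
have delta0 : 0 < delta by rewrite mulr_gt0 ?invr_gt0 ?ltr0n ?logistic_gt0.
have delta20 : 0 < delta / 2 by rewrite divr_gt0.
have [rho [rho0 rhoE]] := exists_large_radius _ _ _ a0 g0 delta20.
have rhor0 : 0 < rho `^ r by exact: powR_gt0.
near=> lambda.
have l0 : 0 < lambda by near: lambda; exact: nbhs_right_gt.
rewrite ltNge; apply/negP => ThetaK.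
have : delta <= reg_loss f x y r lambda (Theta lambda).
  apply: le_trans (reg_loss_ge _ _ _ _ _ _).
  rewrite ler_wpDr ?mulr_ge0 ?powR_ge0 ?(ltW l0)//.
  rewrite ler_pM2l ?invr_gt0 ?ltr0n//; apply: logistic_decreasing.
  exact: (margin_le_powR _ _ _ _ _ homf ubg K0 ThetaK).
apply/negP; rewrite -ltNge.
apply: le_lt_trans (argTheta _ l0 (rho *: v)) _.
apply: le_lt_trans (reg_loss_le _ _ _ _ _ _) _.
rewrite (marginZ _ _ _ _ homf rho0) vg [ltRHS]splitr; apply: ltrD.
  by apply: le_lt_trans rhoE; exact: logistic_le.
have : `|rho *: v| `^ r <= rho `^ r.
  rewrite ge0_ler_powR ?nnegrE ?(ltW r0) ?(ltW rho0)//.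
  by rewrite normrZ gtr0_norm// ler_piMr // ltW.
rewrite -(ler_pM2l l0) => /le_lt_trans; apply.
rewrite -ltr_pdivlMr//; near: lambda; apply: nbhs_right_lt.
by rewrite divr_gt0.
Unshelve. all: by end_near. Qed.

(** * Comparison at equal scale and convergence of the margin *)

Lemma logistic_argmin_le {R : realType} {X : Type} {V : normedModType R}
    {f : X -> V -> R} {a : R} {n : nat} (x : 'I_n.+1 -> X) (y : 'I_n.+1 -> R)
    (r g lambda : R) (theta : V) :
  pos_homogeneous f a -> 0 < r -> 0 < lambda ->
  [set margin f x y theta | theta in [set theta : V | `|theta| <= 1]] g ->
  is_argmin (reg_loss f x y r lambda) theta -> 0 < `|theta| ->
  logistic (`|theta| `^ a * normalized_margin f x y theta)
    <= n.+1%:R * logistic (`|theta| `^ a * g).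
Proof.
move=> homf r0 l0 [v /= v1 vg] argtheta theta0.
rewrite -(marginZ _ _ _ _ homf theta0) scalerA divff ?gt_eqF// scale1r.
rewrite -vg -(marginZ _ _ _ _ homf theta0) -ler_pdivrMl ?ltr0n//.
(* The competitor has no larger penalty, so the penalty terms cancel. *)
have reg : lambda * `| `|theta| *: v| `^ r <= lambda * `|theta| `^ r.
  rewrite ler_pM2l// ge0_ler_powR ?nnegrE ?(ltW r0)//.
  by rewrite normrZ normr_id ler_piMr.
rewrite -(lerD2r (lambda * `|theta| `^ r)).
apply: le_trans (reg_loss_ge _ _ _ _ _ _) _.
apply: le_trans (argtheta (`|theta| *: v)) _.
by apply: le_trans (reg_loss_le _ _ _ _ _ _) _; rewrite lerD2l.
Qed.

(** The two-sided exponential bounds give exp(s(g - u)) <= 2N, and t <= exp(t). *)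
Lemma gap_le_of_logistic_le {R : realType} (N s u g : R) :
  0 <= s -> 0 <= u -> logistic (s * u) <= N * logistic (s * g) -> 0 <= N ->
  s * (g - u) <= 2 * N.
Proof.
move=> s0 u0 le_log N0.
have : expR (- (s * u)) / 2 <= N * expR (- (s * g)).
  apply: (le_trans (logistic_ge (s * u) (mulr_ge0 s0 u0))).
  by apply: (le_trans le_log); rewrite ler_wpM2l// logistic_le.
have -> : - (s * u) = s * (g - u) + - (s * g) by ring.
rewrite expRD mulrAC ler_pM2r ?expR_gt0// ler_pdivrMr// (mulrC N) => le_N.
apply: le_trans le_N; apply: le_trans (expR_ge1Dx _).
by rewrite lerDr.
Qed.

Theorem theorem4p1 (R : realType) (d : nat) (V : normedModType R)
    (V_findim : finite_dimensional V)
    (f : 'rV[R]_d -> V -> R) (a : R) (a_gt0 : 0 < a)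
    (f_homog : pos_homogeneous f a)
    (f_cont : forall x : 'rV[R]_d, continuous (f x))
    (n : nat) (x : 'I_n.+1 -> 'rV[R]_d) (y : 'I_n.+1 -> R)
    (y_sign : forall i : 'I_n.+1, y i = 1 \/ y i = -1)
    (r : R) (r_gt0 : 0 < r) :
  is_max [set margin f x y theta | theta in [set theta : V | `|theta| <= 1]]
         (max_margin f x y) /\
  (forall lambda : R, 0 < lambda ->
     exists theta : V, is_argmin (reg_loss f x y r lambda) theta) /\
  (0 < max_margin f x y ->
   forall Theta : R -> V,
     (forall lambda : R, 0 < lambda ->
        is_argmin (reg_loss f x y r lambda) (Theta lambda)) ->
     normalized_margin f x y (Theta lambda) @[lambda --> 0^'+]
       --> max_margin f x y).
Proof.
have maxM := margin_maximum x y V_findim f_cont.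
split; [exact: maxM|split] => [lambda lambda0|].
  exact: reg_loss_argmin.
move: (max_margin f x y) maxM => g maxM g0 Theta argTheta.
have [max_g ub_g] := maxM.
pose N : R := n.+1%:R.
apply/cvgrPdist_le => e e0.
(* Capping at [g] keeps g - e' nonnegative, as the lower bound on [logistic] requires. *)
pose e' := Num.min e g.
have e'0 : 0 < e' by rewrite lt_min e0.
(* The first summand solves K^a e' = 2N; adding 1 makes the inequality strict. *)
pose K := (2 * N / e') `^ a^-1 + 1.
have K0 : 0 < K by rewrite ltr_wpDl// powR_ge0.
have KE : 2 * N < K `^ a * e'.
  rewrite -ltr_pdivrMr//.
  have {1}-> : 2 * N / e' = ((2 * N / e') `^ a^-1) `^ a.
    rewrite -powRrM mulVf ?gt_eqF// powRr1// divr_ge0 ?(ltW e'0)//.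
    by rewrite mulr_ge0// ler0n.
  by rewrite gt0_ltr_powR ?nnegrE ?powR_ge0// ?(ltW K0)// ltrDl.
have large := argmin_norm_large _ _ _ _ _ f_homog a_gt0 r_gt0 g0 maxM argTheta
  _ K0.
near=> lambda.
have lambda0 : 0 < lambda by near: lambda; exact: nbhs_right_gt.
have Theta_large : K < `|Theta lambda|.
  by near: lambda; exact: large.
have Theta0 : 0 < `|Theta lambda| := lt_trans K0 Theta_large.
have le_g : normalized_margin f x y (Theta lambda) <= g.
  apply: ub_g; exists (`|Theta lambda|^-1 *: Theta lambda) => //=.
  by rewrite normrZ gtr0_norm ?invr_gt0// mulVf// gt_eqF.
rewrite ger0_norm ?subr_ge0// lerBlDr -lerBlDl.
rewrite (@le_trans _ _ (g - e'))//; first by rewrite lerD2l lerN2 ge_min lexx.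
rewrite leNgt; apply/negP => lt_ge'.
have s0 : 0 < `|Theta lambda| `^ a by exact: powR_gt0.
(* The gap bound is applied to g - e' rather than to the margin, which could be negative;
   monotonicity of [logistic] allows the exchange. *)
have gap : `|Theta lambda| `^ a * (g - (g - e')) <= 2 * N.
  apply: gap_le_of_logistic_le; rewrite ?(ltW s0) ?ler0n//.
    by rewrite subr_ge0 ge_min lexx orbT.
  apply: le_trans
    (logistic_argmin_le _ _ _ _ _ _ f_homog r_gt0 lambda0 max_g
      (argTheta _ lambda0) Theta0).
  by apply: logistic_decreasing; rewrite ler_pM2l// ltW.
have : `|Theta lambda| `^ a * e' <= K `^ a * e'.
  by move: gap; rewrite subKr => /le_trans; apply; exact: ltW.
by rewrite ler_pM2r// leNgt gt0_ltr_powR ?nnegrE ?(ltW K0)// ltW.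
Unshelve. all: by end_near. Qed.
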